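(* Let $n\ge1$ and let $c_{-1},c_0,\dots,c_n$ be real constants. Put $$F(p_1,\dots,p_n)=\sum_{k=0}^n c_k\sigma_k(p),\qquad G(p_1,\dots,p_n)=\sum_{k=0}^n c_{k-1}\sigma_k(p).$$ Suppose that real-valued $C^2$ functions $p_1(s),\dots,p_n(s)$ and $r(s)$ on an interval $I\subset\mathbb{R}$ satisfy $$\frac{p_i''}{2}\,F(p_1,\dots,p_n)=(p_i')^2\,\frac{\partial F}{\partial p_i}(p_1,\dots,p_n)\quad(i=1,\dots,n),\qquad r''\,F(p_1,\dots,p_n)=-G(p_1,\dots,p_n).$$ Then the function $$u(z_1,\dots,z_{n+1})=2\sum_{j=1}^n p_j(\operatorname{Re}z_{n+1})\,(\operatorname{Re}z_j)^2+4\,r(\operatorname{Re}z_{n+1})$$ satisfies the complex Hessian equation $$c_n\sigma_{n+1}(\partial\bar\partial u)+c_{n-1}\sigma_n(\partial\bar\partial u)+\cdots+c_0\sigma_1(\partial\bar\partial u)+c_{-1}=0$$ (at points of $\mathbb{C}^{n+1}$ with $\operatorname{Re}z_{n+1}\in I$), and the function $$f(x_1,\dots,x_n,s)=\frac12\sum_{j=1}^n p_j(s)\,x_j^2+r(s)$$ satisfies the real Hessian equation $$c_n\sigma_{n+1}(\nabla^2f)+c_{n-1}\sigma_n(\nabla^2f)+\cdots+c_0\sigma_1(\nabla^2f)+c_{-1}=0$$ (at points of $\mathbb{R}^{n+1}$ with $s\in I$).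
   Context: $\sigma_k(p)$ is the $k$-th elementary symmetric polynomial of $p_1,\dots,p_n$ ($\sigma_0=1$). For an $(n+1)\times(n+1)$ Hermitian (or real symmetric) matrix $M$, $\sigma_k(M)$ is the $k$-th elementary symmetric polynomial of its eigenvalues. $\partial\bar\partial u$ denotes the matrix $\bigl[\frac{\partial^2u}{\partial z_j\partial\bar z_k}\bigr]_{1\le j,k\le n+1}$ and $\nabla^2 f$ the real Hessian matrix of $f$ in the coordinates $(x_1,\dots,x_n,s)$ of $\mathbb{R}^{n+1}$. For the two ansatz functions the entries of these matrices involving second derivatives in $\operatorname{Re}z_{n+1}$ (resp. $s$) are computed using $p_j',p_j'',r''$. Primes denote $d/ds$. *)

(* Defs.v *)
From mathcomp Require Import all_boot all_order all_algebra.
From mathcomp Require mpoly.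
From mathcomp Require Import complex.
From mathcomp Require Import boolp classical_sets reals topology normedtype.

Set Implicit Arguments.
Unset Strict Implicit.
Unset Printing Implicit Defensive.

(* The notations of mpoly clash with those of topology. *)
Import -(notations) mpoly.
Import Order.TTheory GRing.Theory Num.Theory numFieldNormedType.Exports.

Local Open Scope classical_set_scope.
Local Open Scope ring_scope.
Local Open Scope complex_scope.

(* Derivatives of a real function on a set S: the difference quotient is only
   taken at points of S, so that the derivative is the ordinary one at interior
   points of S and one-sided at an endpoint belonging to S. *)
Section DerivativeWithin.
Variable R : realType.
Implicit Types (S : set R) (g : R -> R) (t : R).

Definition diff_quotient g t : R -> R := fun s => (g s - g t) / (s - t).

Definition derivable_within S g t : Prop :=
  cvg (diff_quotient g t @ within S t^').

Definition derive_within S g t : R := lim (diff_quotient g t @ within S t^').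

Definition C2_on S g : Prop :=
  [/\ forall t, S t -> derivable_within S g t,
      forall t, S t -> derivable_within S (derive_within S g) t &
      {within S, continuous (derive_within S (derive_within S g))}].

End DerivativeWithin.

(* Partial derivatives on D of real functions on a space T whose real
   coordinates are indexed by J: [shift j h x] adds h to the j-th real
   coordinate of x. *)
Section PartialDerivatives.
Variables (R : realType) (T J : Type) (shift : J -> R -> T -> T) (D : set T).
Implicit Types (f : T -> R) (j : J) (x : T).

Definition pderivable j f x : Prop :=
  derivable_within [set h | D (shift j h x)] (fun h => f (shift j h x)) 0.

Definition pderive j f x : R :=
  derive_within [set h | D (shift j h x)] (fun h => f (shift j h x)) 0.

Definition twice_pderivable f : Prop :=
  (forall j x, D x -> pderivable j f x) /\
  (forall j k x, D x -> pderivable j (pderive k f) x).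

End PartialDerivatives.

Section RealHessian.
Variables (R : realType) (m : nat).

Definition real_shift (j : 'I_m) (h : R) (x : 'rV[R]_m) : 'rV[R]_m :=
  x + h *: delta_mx 0 j.

Definition real_hessian (D : set 'rV[R]_m) (f : 'rV[R]_m -> R) (x : 'rV[R]_m) :
    'M[R]_m :=
  \matrix_(j, k) pderive real_shift D j (pderive real_shift D k f) x.

End RealHessian.

Section ComplexHessian.
Variables (R : realType) (m : nat).

(* (j, false) is the coordinate Re z_j and (j, true) the coordinate Im z_j. *)
Definition complex_shift (j : 'I_m * bool) (h : R) (z : 'rV[R[i]]_m) :
    'rV[R[i]]_m :=
  z + (if j.2 then 0 +i* h else h%:C) *: delta_mx 0 j.1.

Variable D : set 'rV[R[i]]_m.
Implicit Types (g : 'rV[R[i]]_m -> R[i]) (z : 'rV[R[i]]_m).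

Definition cpderive (j : 'I_m * bool) g z : R[i] :=
  pderive complex_shift D j (fun w => complex.Re (g w)) z +i*
  pderive complex_shift D j (fun w => complex.Im (g w)) z.

Definition dz (j : 'I_m) g z : R[i] :=
  (cpderive (j, false) g z - (0 +i* 1) * cpderive (j, true) g z) / 2.

Definition dzbar (j : 'I_m) g z : R[i] :=
  (cpderive (j, false) g z + (0 +i* 1) * cpderive (j, true) g z) / 2.

Definition complex_hessian (u : 'rV[R[i]]_m -> R) z : 'M[R[i]]_m :=
  \matrix_(j, k) dz j (dzbar k (fun w => (u w)%:C)) z.

End ComplexHessian.

Section Sigma.

Definition esym (K : comNzRingType) (n k : nat) (p : 'I_n -> K) : K :=
  meval p (mesym n K k).

(* The eigenvalues of M, listed with algebraic multiplicity. *)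
Definition eigenvalues (K : closedFieldType) (m : nat) (M : 'M[K]_m) : seq K :=
  sval (closed_field_poly_normal (char_poly M)).

Definition sigma_mx (K : closedFieldType) (m : nat) (k : nat) (M : 'M[K]_m) : K :=
  let e := eigenvalues M in esym k (fun i : 'I_(size e) => e`_i).

End Sigma.

(* The constants c_{-1}, ..., c_n are values of a function on int. *)
Section Ansatz.
Variables (R : realType) (n : nat) (c : int -> R).

Definition Fpoly : mpoly n R :=
  \sum_(k < n.+1) c k%:Z *: mesym n R k.

Definition F (p : 'I_n -> R) : R := meval p Fpoly.

Definition dF (i : 'I_n) (p : 'I_n -> R) : R :=
  meval p (mderiv i Fpoly).

Definition G (p : 'I_n -> R) : R :=
  \sum_(k < n.+1) c (k%:Z - 1) * esym k p.

(* The left-hand side of the Hessian equation for a Hermitian matrix M. *)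
Definition hessian_lhs (M : 'M[R[i]]_n.+1) : R[i] :=
  \sum_(k < n.+1) (c k%:Z)%:C * sigma_mx k.+1 M + (c (-1))%:C.

Variables (p : 'I_n -> R -> R) (r : R -> R).

(* The coordinates z_1, ..., z_n are those of index [widen_ord (leqnSn n) j],
   and z_{n+1} (or s in the real case) is that of index [ord_max]. *)
Definition u_ansatz (z : 'rV[R[i]]_n.+1) : R :=
  let s := complex.Re (z 0 ord_max) in
  2 * (\sum_(j < n) p j s * complex.Re (z 0 (widen_ord (leqnSn n) j)) ^+ 2)
  + 4 * r s.

Definition f_ansatz (x : 'rV[R]_n.+1) : R :=
  let s := x 0 ord_max in
  2^-1 * (\sum_(j < n) p j s * x 0 (widen_ord (leqnSn n) j) ^+ 2) + r s.

End Ansatz.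

(* Main.v *)
(* The real Hessian of f is the arrow matrix with diagonal block diag(p_j), last
   column (p_j' x_j)_j and corner w = (1/2) sum_j p_j'' x_j^2 + r''. By a Schur
   complement its k-th elementary symmetric function is
     sigma_k(p) + w sigma_(k-1)(p)
       - sum_j (p_j' x_j)^2 d(sigma_(k-1))/d(p_j),
   so the left-hand side of the Hessian equation is
     G + w F - sum_j (p_j' x_j)^2 dF/dp_j,
   which vanishes term by term in the x_j^2 by the differential equations.
   The function u only depends on the real parts of the coordinates, so its
   complex Hessian is a quarter of the real Hessian of 4 f. *)

Require Import Defs.
From mathcomp Require Import all_boot all_order all_algebra.
From mathcomp Require mpoly.
From mathcomp Require Import complex ring lra zify.
From mathcomp Require Import boolp classical_sets reals topology normedtype.

Set Implicit Arguments.
Unset Strict Implicit.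
Unset Printing Implicit Defensive.

Import -(notations) mpoly.
Import Order.TTheory GRing.Theory Num.Theory numFieldNormedType.Exports.

Local Open Scope classical_set_scope.
Local Open Scope ring_scope.
Local Open Scope complex_scope.

(** * Splitting the indices into the first n coordinates and the last one *)

Section LastCoordinate.
Variable n : nat.
Local Notation w := (widen_ord (leqnSn n)).

Lemma ord_max_or_widen (j : 'I_n.+1) : j = ord_max \/ exists i, j = w i.
Proof.
case: (unliftP ord_max j) => [i|] ->; [right | by left].
by exists i; apply: val_inj; rewrite [LHS]lift_max.
Qed.

Lemma widen_ord_max i : (w i == ord_max) = false.
Proof. by apply/negbTE; rewrite neq_ltn /= ltn_ord. Qed.

Lemma eq_widen i j : (w i == w j) = (i == j).
Proof. by rewrite -!val_eqE. Qed.

Lemma unlift_widen i : unlift ord_max (w i) = Some i.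
Proof.
rewrite (_ : w i = lift ord_max i) ?liftK//.
by apply: val_inj; rewrite [RHS]lift_max.
Qed.

End LastCoordinate.

(** * Elementary symmetric functions as coefficients of characteristic polynomials *)

Local Notation mX K i := (mpolyX K (mnm1 i)).

Lemma esymE (K : comNzRingType) (n k : nat) (a : 'I_n -> K) :
  Defs.esym k a = \sum_(h : {set 'I_n} | #|h| == k) \prod_(i in h) a i.
Proof.
rewrite /Defs.esym /mesym rmorph_sum; apply: eq_bigr => h _.
by rewrite rmorph_prod; apply: eq_bigr => i _; rewrite /= mevalXU.
Qed.

(** Vieta's formula. Expanding the product, [h] collects the indices whose factor contributes its
    constant term, so the remaining factors give a power of X with exponent the size of the
    complement of [h]. *)
Lemma coef_prod_XsubC_ord (K : comNzRingType) (n k : nat) (a : 'I_n -> K) :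
  (k <= n)%N ->
  (\prod_(i < n) ('X - (a i)%:P))`_(n - k) =
  (-1) ^+ k * \sum_(h : {set 'I_n} | #|h| == k) \prod_(i in h) a i.
Proof.
move=> kn; under eq_bigr => i _ do rewrite addrC -raddfN/=.
rewrite bigA_distr coef_sum mulr_sumr.
rewrite [RHS]big_mkcond/=; apply: eq_bigr => h _.
rewrite big_if/= big_const iter_mulr_1 -rmorph_prod/= coefCM coefXn prodrN.
have -> : (n - k == #|[pred i | i \notin h]|)%N = (#|h| == k).
  have := cardC h; rewrite card_ord => hn.
  by apply/eqP/eqP; move: hn; set c := #|[predC _]|; rewrite -/c; lia.
by case: eqP => [->|_]; rewrite ?mulr1 ?mulr0.
Qed.

Lemma sigma_mxE (K : closedFieldType) (m k : nat) (M : 'M[K]_m) :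
  (k <= m)%N -> sigma_mx k M = (-1) ^+ k * (char_poly M)`_(m - k).
Proof.
move=> km; rewrite /sigma_mx /eigenvalues.
case: closed_field_poly_normal => e /= eE.
have := eE; rewrite (monicP (char_poly_monic M)) scale1r => cE.
(* The list of eigenvalues has length [m]; Vieta's formula for that list then reads off the
   coefficient of index [m - k]. *)
have sz : size e = m.
  by apply: succn_inj; rewrite -(size_prod_XsubC e id) -cE size_char_poly.
rewrite cE (big_nth 0) big_mkord -[in (m - k)%N]sz.
rewrite coef_prod_XsubC_ord ?sz// esymE.
by rewrite mulrA -exprD addnn -signr_odd odd_double mul1r.
Qed.

(** The factor with index j is absent, so no coefficient involves X_j. *)
Lemma mderiv_coef_prod (K : comNzRingType) (n m : nat) (j : 'I_n)
    (Q : pred 'I_n) :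
  ~~ Q j ->
  mderiv j (\prod_(i < n | Q i) ('X - (mX K i)%:P))`_m = 0.
Proof.
move=> Qj; elim/big_rec: _ m => [|i q Qi IH] m.
  by rewrite -polyC1 coefC; case: eqP => _; rewrite ?mderiv0 // -mpolyC1 mderivC.
rewrite mulrBl coefB coefXM coefCM mderivB mderivM IH mulr0 addr0.
have -> : mderiv j (mX K i) = 0.
  rewrite mderivX mnm1E (_ : (i == j) = false) ?scale0r //.
  by apply: contraNF Qj => /eqP <-.
by rewrite mul0r subr0; case: eqP => _; rewrite ?IH ?mderiv0.
Qed.

(** These products with one factor deleted occur in the determinant of X - M for an arrow matrix M.
    The identity is proved for indeterminates, where differentiation makes sense, and then
    specialised by [meval a]. *)
Lemma coef_prod_XsubC_mderiv (K : comNzRingType) (n k : nat) (j : 'I_n)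
    (a : 'I_n -> K) : (k <= n)%N ->
  (\prod_(i < n | i != j) ('X - (a i)%:P))`_(n - k) =
  (-1) ^+ k.+1 * meval a (mderiv j (mesym n K k)).
Proof.
move=> kn.
have -> : \prod_(i < n | i != j) ('X - (a i)%:P) =
    map_poly (meval a)
      (\prod_(i < n | i != j) ('X - (mX K i)%:P)).
  rewrite rmorph_prod; apply: eq_bigr => i _.
  by rewrite rmorphB/= map_polyX map_polyC/= mevalXU.
(* q = (X - X_j) Q with Q free of X_j, so the derivation in X_j maps q to -Q. *)
have E : (-1) ^+ k * mderiv j (mesym n K k) =
    - (\prod_(i < n | i != j) ('X - (mX K i)%:P))`_(n - k).
  transitivity
    (mderiv j (\prod_(i < n) ('X - (mX K i)%:P))`_(n - k)).
    rewrite coef_prod_XsubC_ord // -signr_odd; case: odd; last by rewrite !mul1r.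
    by rewrite expr1 !mulN1r mderivN.
  rewrite (bigD1 j) //= mulrBl coefB coefXM coefCM mderivB mderivM.
  rewrite mderiv_coef_prod ?eqxx // mulr0 addr0 mderivX mnm1E eqxx scale1r.
  rewrite (_ : mnm_sub (mnm1 j) (mnm1 j) = mnm0) ?mpolyX0 ?mul1r; last first.
    by apply/mnmP => i; rewrite mnmBE mnm0E subnn.
  by case: eqP => _; rewrite ?mderiv0 ?mderiv_coef_prod ?eqxx ?sub0r.
rewrite coef_map -[LHS]opprK -rmorphN/= -E rmorphM/= rmorphXn rmorphN1.
by rewrite exprS mulN1r mulNr.
Qed.

(** * Determinant and symmetric functions of arrow matrices *)

Lemma det_block_arrow (K : idomainType) (n : nat) (d : 'I_n -> K)
    (B : 'cV[K]_n) (C : 'rV[K]_n) (w : 'M[K]_1) :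
  \prod_i d i != 0 ->
  \det (block_mx (diag_mx (\row_i d i)) B C w) =
  w 0 0 * \prod_i d i - \sum_j C 0 j * B j 0 * \prod_(i | i != j) d i.
Proof.
set a := \prod_i d i => a0.
(* [E] is the adjugate of the diagonal block; it replaces the inverse, which need not exist over a
   domain. *)
pose E : 'M[K]_n := diag_mx (\row_j \prod_(i | i != j) d i).
have AE : diag_mx (\row_i d i) *m E = a%:M.
  apply/matrixP => i k; rewrite mul_diag_mx !mxE.
  by case: eqP => _; rewrite ?mulr0n ?mulr0 // !mulr1n /a [RHS](bigD1 i).
have detA : \det (diag_mx (\row_i d i)) = a.
  by rewrite det_diag; apply: eq_bigr => i _; rewrite mxE.
(* the Schur complement of the diagonal block, cleared of denominators *)
have := det_mulmx (block_mx (diag_mx (\row_i d i)) B C w)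
                  (block_mx 1%:M (- (E *m B)) 0 a%:M).
rewrite mulmx_block !mulmx1 !mulmx0 !addr0 !mulmxN !mulmxA AE.
rewrite mul_scalar_mx mul_mx_scalar addNr det_lblock det_ublock det1 mul1r.
(* Both sides carry the factor [a]: on one side from the multiplier matrix, on the other from the
   diagonal block. It is cancelled. *)
rewrite det_scalar1 detA mulrC => /(mulIf a0) <-.
rewrite det_mx11 mul_mx_scalar !mxE addrC [a * _]mulrC; congr (_ - _).
apply: eq_bigr => j _; rewrite mul_mx_diag !mxE; ring.
Qed.

Lemma det_arrow (K : idomainType) (n : nat) (d : 'I_n -> K) (M : 'M[K]_n.+1) :
  let w i := widen_ord (leqnSn n) i in
  (forall i j, M (w i) (w j) = d i *+ (i == j)) ->
  \prod_i d i != 0 ->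
  \det M = M ord_max ord_max * \prod_i d i -
    \sum_j M ord_max (w j) * M (w j) ord_max * \prod_(i | i != j) d i.
Proof.
move=> w Md d0.
(* Block matrices have size [n + 1], which is not convertible to [n.+1], so the indices are
   transported along a cast. *)
pose e : 'I_(n + 1) -> 'I_n.+1 := cast_ord (addn1 n).
have castK m m' (E : m = m') (A : 'M[K]_m') :
    \det A = \det (mxsub (cast_ord E) (cast_ord E) A).
  case: m' / E A => A; congr (\det _).
  by apply/matrixP => i j; rewrite mxE !cast_ord_id.
rewrite (castK _ _ (addn1 n)) -/e.
have el i : e (lshift 1 i) = w i by exact: val_inj.
have er : e (rshift n 0) = ord_max by apply: val_inj; rewrite /= addn0.
rewrite -[mxsub e e M]submxK.
rewrite (_ : ulsubmx _ = diag_mx (\row_i d i)); last first.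
  by apply/matrixP => i j; rewrite !mxE !el Md.
rewrite det_block_arrow // !mxE er; congr (_ - _).
by apply: eq_bigr => j _; rewrite !mxE el er.
Qed.

Lemma esym_gt (K : comNzRingType) (n k : nat) (a : 'I_n -> K) :
  (n < k)%N -> Defs.esym k a = 0.
Proof. by move=> nk; rewrite /Defs.esym mesym_geqnE// meval0. Qed.

(** X - M is again an arrow matrix, with diagonal entries X - d_i over the polynomial ring. Their
    product is monic, hence nonzero, so [det_arrow] applies for every d. *)
Lemma char_poly_arrow_coef (K : idomainType) (n k : nat) (d : 'I_n -> K)
    (M : 'M[K]_n.+1) :
  let w i := widen_ord (leqnSn n) i in
  (k <= n)%N ->
  (forall i j, M (w i) (w j) = d i *+ (i == j)) ->
  (char_poly M)`_(n - k) = (-1) ^+ k.+1 *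
    (Defs.esym k.+1 d + M ord_max ord_max * Defs.esym k d
     - \sum_j M ord_max (w j) * M (w j) ord_max
         * meval d (mderiv j (mesym n K k))).
Proof.
move=> w kn Md; rewrite /char_poly.
rewrite (@det_arrow _ _ (fun i => 'X - (d i)%:P)); last first.
- by rewrite monic_neq0 ?monic_prod_XsubC.
- move=> i j; rewrite !mxE Md.
  rewrite eq_widen.
  by case: eqP => _; rewrite ?mulr1n // !mulr0n subrr.
rewrite coefB coef_sum mulrBr; congr (_ - _); last first.
  rewrite mulr_sumr; apply: eq_bigr => j _.
  rewrite !mxE widen_ord_max eq_sym widen_ord_max !sub0r mulrNN -polyCM.
  by rewrite coefCM coef_prod_XsubC_mderiv// mulrCA.
rewrite !mxE eqxx mulr1n mulrBl coefB coefXM coefCM.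
rewrite coef_prod_XsubC_ord// -esymE mulrDr; congr (_ + _); last first.
  by rewrite exprS mulN1r mulNr mulrCA.
(* For k = n the product with X has no constant term, in agreement with the vanishing of the
   symmetric function of degree n+1 in n variables. Otherwise the factor X lowers the index by
   one. *)
case: eqP => [nk|nk].
  by rewrite esym_gt ?mulr0//; lia.
rewrite (_ : (n - k).-1 = n - k.+1)%N; last by lia.
by rewrite coef_prod_XsubC_ord -?esymE//; lia.
Qed.

(** The eigenvalues are taken in R[i], but the characteristic polynomial is the image of a real one,
    and the two signs (-1)^(k+1) cancel. *)
Lemma sigma_mx_arrow (R : rcfType) (n k : nat) (d : 'I_n -> R)
    (M : 'M[R]_n.+1) :
  let w i := widen_ord (leqnSn n) i in
  (k <= n)%N ->
  (forall i j, M (w i) (w j) = d i *+ (i == j)) ->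
  sigma_mx k.+1 (map_mx (fun a : R => a%:C) M) =
    (Defs.esym k.+1 d + M ord_max ord_max * Defs.esym k d
     - \sum_j M ord_max (w j) * M (w j) ord_max
         * meval d (mderiv j (mesym n R k)))%:C.
Proof.
move=> w kn Md; rewrite sigma_mxE// subSS -map_char_poly coef_map/=.
rewrite (char_poly_arrow_coef kn Md) rmorphM rmorphXn rmorphN1 mulrA -exprD.
by rewrite addnn -signr_odd odd_double mul1r.
Qed.

Lemma hessian_lhs_arrow (R : realType) (n : nat) (c : int -> R) (d : 'I_n -> R)
    (M : 'M[R]_n.+1) :
  let w i := widen_ord (leqnSn n) i in
  (forall i j, M (w i) (w j) = d i *+ (i == j)) ->
  hessian_lhs c (map_mx (fun a : R => a%:C) M) =
    (G c d + M ord_max ord_max * F c d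
     - \sum_j M ord_max (w j) * M (w j) ord_max * dF c j d)%:C.
Proof.
move=> w Md; rewrite /hessian_lhs.
under eq_bigr => k _ do
  rewrite (sigma_mx_arrow (ltn_ord k : (k <= n)%N) Md) -rmorphM.
rewrite -rmorph_sum -rmorphD; congr (_%:C).
have FE : F c d = \sum_(k < n.+1) c k * Defs.esym k d.
  by rewrite /F /Fpoly rmorph_sum; apply: eq_bigr => k _; rewrite /= mevalZ.
have dFE j : dF c j d = \sum_(k < n.+1) c k * meval d (mderiv j (mesym n R k)).
  rewrite /dF /Fpoly (linear_sum (mderiv j)) (rmorph_sum (meval d)).
  apply: eq_bigr => k _.
  by rewrite /= mderivZ mevalZ.
(* Index shift: the term k = 0 of [G] is the free constant c_(-1), and the extra top term on the
   right contains the symmetric function of degree n+1, which is zero. *)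
have GE : G c d = \sum_(k < n.+1) c k * Defs.esym k.+1 d + c (-1).
  rewrite /G big_ord_recl big_ord_recr/= [Defs.esym n.+1 d]esym_gt// mulr0 addr0.
  rewrite sub0r addrC /Defs.esym mesym0E meval1 mulr1; congr (_ + _).
  by apply: eq_bigr => k _; congr (c _ * _); rewrite /bump/=; lia.
under eq_bigr => k _ do rewrite mulrBr mulrDr.
rewrite sumrB big_split/= GE FE [M _ _ * \sum_(k < _) _]mulr_sumr.
under [X in _ + X - _ + _]eq_bigr => k _ do rewrite mulrCA.
under [X in _ - X + _]eq_bigr => k _ do rewrite mulr_sumr.
under [X in _ = _ - X]eq_bigr => j _ do rewrite dFE mulr_sumr.
rewrite exchange_big/= addrAC; congr (_ - _); first by ring.
by apply: eq_bigr => j _; apply: eq_bigr => k _; rewrite mulrCA.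
Qed.

(** * Calculus of derivatives within a set *)

Section IsDeriveWithin.
Variable R : realType.
Implicit Types (S : set R) (g : R -> R) (t l : R).

(** Convergence to an explicit value: the calculus rules then hold even at isolated points, and
    non-isolation enters only when [lim] has to be evaluated. *)
Definition is_derive_within S g t l : Prop :=
  diff_quotient g t @ within S t^' --> l.

Lemma is_derive_withinP S g t l :
  is_derive_within S g t l <->
  forall e, 0 < e -> exists2 d, 0 < d &
    forall s, S s -> s != t -> `|s - t| < d -> `|diff_quotient g t s - l| < e.
Proof.
split=> [/cvgrPdist_lt H e e0|H].
  have [d /= d0 Hd] := H e e0; exists d => // s Ss st std.
  by rewrite distrC; apply: Hd => //=; rewrite distrC.
apply/cvgrPdist_lt => e e0; have [d d0 Hd] := H e e0.
exists d => //= s; rewrite /ball_/= => std st Ss.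
by rewrite distrC; apply: Hd => //; rewrite distrC.
Qed.

Lemma derivable_withinP S g t :
  derivable_within S g t -> is_derive_within S g t (derive_within S g t).
Proof. by []. Qed.

Lemma eq_is_derive_within S g g' t l :
  (forall s, S s -> g s = g' s) -> S t ->
  is_derive_within S g t l -> is_derive_within S g' t l.
Proof.
move=> gg' St /is_derive_withinP H; apply/is_derive_withinP => e e0.
have [d d0 Hd] := H e e0; exists d => // s Ss st std.
by rewrite /diff_quotient -!gg' //; exact: Hd.
Qed.

Lemma is_derive_within_shift S g t l :
  is_derive_within S g t l ->
  is_derive_within [set h | S (t + h)] (fun h => g (t + h)) 0 l.
Proof.
move=> /is_derive_withinP H; apply/is_derive_withinP => e e0.
have [d d0 Hd] := H e e0; exists d => // h /= Sh h0; rewrite subr0 => hd.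
have := Hd (t + h) Sh; rewrite /diff_quotient addr0 subr0 [t + h - t]addrC addKr.
by apply => //; rewrite -subr_eq0 [_ - t]addrC addKr.
Qed.

Lemma is_derive_within_cst S t a : is_derive_within S (fun=> a) t 0.
Proof.
apply/is_derive_withinP => e e0; exists 1 => // s _ _ _.
by rewrite /diff_quotient subrr mul0r subrr normr0.
Qed.

Lemma is_derive_within_sqr S a :
  is_derive_within S (fun h => (a + h) ^+ 2) 0 (2 * a).
Proof.
(* The error of the difference quotient is exactly h, so the radius [e] itself works. *)
apply/is_derive_withinP => e e0; exists e => // h _ h0; rewrite subr0 => he.
rewrite /diff_quotient (_ : _ - _ = h) //; field; exact: h0.
Qed.

Lemma is_derive_within_add_cst S a : is_derive_within S (fun h => a + h) 0 1.
Proof.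
apply/is_derive_withinP => e e0; exists 1 => // h _ h0 _.
rewrite /diff_quotient (_ : _ - _ = 0) ?normr0//; field; exact: h0.
Qed.

Lemma is_derive_withinD S g1 g2 t l1 l2 :
  is_derive_within S g1 t l1 -> is_derive_within S g2 t l2 ->
  is_derive_within S (fun s => g1 s + g2 s) t (l1 + l2).
Proof.
move=> H1 H2; rewrite /is_derive_within.
rewrite (_ : diff_quotient _ t = diff_quotient g1 t \+ diff_quotient g2 t).
  exact: cvgD.
by apply/funext => s; rewrite /diff_quotient/=; ring.
Qed.

Lemma is_derive_withinZ S g t l a :
  is_derive_within S g t l -> is_derive_within S (fun s => a * g s) t (a * l).
Proof.
move=> H; rewrite /is_derive_within.
rewrite (_ : diff_quotient _ t = fun s => a * diff_quotient g t s).
  by apply: cvgM => //; exact: cvg_cst.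
by apply/funext => s; rewrite /diff_quotient/=; ring.
Qed.

Lemma is_derive_within_sum S (n : nat) (g : 'I_n -> R -> R) t (l : 'I_n -> R) :
  (forall i, is_derive_within S (g i) t (l i)) ->
  is_derive_within S (fun s => \sum_i g i s) t (\sum_i l i).
Proof.
move=> H; elim: (index_enum _) => [|i s IH].
  under eq_fun do rewrite big_nil; rewrite big_nil.
  exact: is_derive_within_cst.
under eq_fun do rewrite big_cons; rewrite big_cons.
exact: is_derive_withinD.
Qed.

(* Without it the filter of [derive_within] is improper and [lim] is junk. *)
Definition nonisolated S t :=
  forall e, 0 < e -> exists s, [/\ S s, s != t & `|s - t| < e].

(** Non-isolation makes the filter proper, and limits in a Hausdorff space along a proper filter are
    unique. *)
Lemma derive_withinE S g t l : nonisolated S t ->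
  is_derive_within S g t l ->
  derivable_within S g t /\ derive_within S g t = l.
Proof.
move=> St gl.
have PF : ProperFilter (within S t^').
  apply: Build_ProperFilter_ex => B [d /= d0 Bd].
  have [s [Ss st std]] := St d d0; exists s; apply: Bd => //=.
  by rewrite distrC.
by split; [apply/cvg_ex; exists l | exact: cvg_lim].
Qed.

Lemma nonisolated_setT t : nonisolated setT t.
Proof.
move=> e e0; exists (t + e / 2); split=> //.
  by rewrite -subr_eq0 [_ - t]addrC addKr lt0r_neq0 // divr_gt0.
rewrite [_ - t]addrC addKr gtr0_norm ?divr_gt0 //; lra.
Qed.

Lemma nonisolated_shift S t :
  nonisolated S t -> nonisolated [set h | S (t + h)] 0.
Proof.
move=> H e /H[s [Ss st ste]]; exists (s - t); split; rewrite ?subr0//=.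
  by rewrite addrC subrK.
by rewrite subr_eq0.
Qed.

Lemma nonisolated_interval S t : is_interval S ->
  (exists a b : R, [/\ S a, S b & a < b]) -> S t -> nonisolated S t.
Proof.
move=> Si [a [b [Sa Sb ab]]] St e e0.
(* Points near t are found by moving from t towards another point [c] of [S], one of the two given
   points. *)
have [c Sc ct] : exists2 c, S c & c != t.
  by have [ta|ta] := eqVneq a t; [exists b => //; rewrite -ta gt_eqF | exists a].
(* The bound 1 keeps the new point between t and [c], hence in the interval; the other bound makes
   its distance to t at most e/2. *)
pose m := Num.min 1 (e / (2 * `|c - t|)).
have ct0 : 0 < `|c - t| by rewrite normr_gt0 subr_eq0.
have m0 : 0 < m by rewrite /m lt_min ltr01 divr_gt0 // mulr_gt0.
have m1 : m <= 1 by rewrite /m ge_min lexx.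
have me : m * `|c - t| < e.
  apply: (@le_lt_trans _ _ (e / (2 * `|c - t|) * `|c - t|)).
    by rewrite ler_pM2r // /m ge_min lexx orbT.
  rewrite (_ : _ * _ = e / 2); first lra.
  field; exact: lt0r_neq0.
have E : t + m * (c - t) - t = m * (c - t) by rewrite addrC addKr.
exists (t + m * (c - t)); split.
- have [tc|tc] := leP t c.
    by apply: (Si t c) => //; apply/andP; split; nra.
  by apply: (Si c t) => //; apply/andP; split; nra.
- by rewrite -subr_eq0 E mulf_neq0 ?subr_eq0 // lt0r_neq0.
- by rewrite E normrM gtr0_norm.
Qed.

End IsDeriveWithin.

(** * Partial derivatives, for real and complex shifts alike *)

Section PartialDerivative.
Variables (R : realType) (T J : Type) (shift : J -> R -> T -> T) (D : set T).
Implicit Types (f g : T -> R) (j k : J) (x : T) (l : R).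

Definition is_pderive j f x l :=
  is_derive_within [set h | D (shift j h x)] (fun h => f (shift j h x)) 0 l.

Hypothesis shift0 : forall j x, shift j 0 x = x.
Hypothesis accD :
  forall j x, D x -> nonisolated [set h | D (shift j h x)] 0.

Lemma pderiveE j f x l : D x -> is_pderive j f x l ->
  pderivable shift D j f x /\ pderive shift D j f x = l.
Proof. by move=> Dx; apply: derive_withinE; exact: accD. Qed.

Lemma eq_is_pderive j f g x l : (forall w, D w -> f w = g w) -> D x ->
  is_pderive j f x l -> is_pderive j g x l.
Proof.
by move=> fg Dx; apply: eq_is_derive_within => /= [h|]; [exact: fg | rewrite shift0].
Qed.

Lemma eq_pderive j f g x l : (forall w, D w -> f w = g w) -> D x ->
  is_pderive j g x l -> pderive shift D j f x = l.
Proof.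
by move=> fg Dx gl; apply: (pderiveE Dx _).2; apply: eq_is_pderive gl => // w /fg.
Qed.

(** It suffices to exhibit candidates: a derivative within [D] sees only values on [D], where the
    first partial derivative agrees with [f1], so [f1] may be differentiated in its place. *)
Lemma twice_pderivableE f (f1 : J -> T -> R) (f2 : J -> J -> T -> R) :
  (forall j x, D x -> is_pderive j f x (f1 j x)) ->
  (forall j k x, D x -> is_pderive j (f1 k) x (f2 j k x)) ->
  [/\ twice_pderivable shift D f,
      forall j x, D x -> pderive shift D j f x = f1 j x &
      forall j k x, D x ->
        pderive shift D j (pderive shift D k f) x = f2 j k x].
Proof.
move=> H1 H2.
have E1 j x : D x -> pderive shift D j f x = f1 j x.
  by move=> Dx; exact: (pderiveE Dx (H1 _ _ Dx)).2.
have E2 j k x : D x -> is_pderive j (pderive shift D k f) x (f2 j k x).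
  by move=> Dx; apply: eq_is_pderive (H2 _ _ _ Dx) => // w /E1.
split=> //; [split=> [j x Dx|j k x Dx] | move=> j k x Dx].
- exact: (pderiveE Dx (H1 _ _ Dx)).1.
- exact: (pderiveE Dx (E2 _ _ _ Dx)).1.
- exact: (pderiveE Dx (E2 _ _ _ Dx)).2.
Qed.

End PartialDerivative.

(** * Gradient and Hessian of the real ansatz *)

Section RealAnsatz.
Variables (R : realType) (n : nat) (I : set R).
Hypothesis accI : forall t, I t -> nonisolated I t.
Local Notation w := (widen_ord (leqnSn n)).
Local Notation D := [set x : 'rV[R]_n.+1 | I (x 0 ord_max)].
Local Notation is_pd := (is_pderive (@real_shift R n.+1) D).
Implicit Types (p : 'I_n -> R -> R) (r : R -> R) (x : 'rV[R]_n.+1).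

Lemma real_shift0 m (j : 'I_m) (x : 'rV[R]_m) : real_shift j 0 x = x.
Proof. by rewrite /real_shift scale0r addr0. Qed.

Lemma real_shiftE m (j k : 'I_m) h (x : 'rV[R]_m) :
  real_shift j h x 0 k = if k == j then x 0 k + h else x 0 k.
Proof. by rewrite !mxE eqxx /=; case: eqP => _; rewrite ?mulr1 ?mulr0 ?addr0. Qed.

Lemma real_shift_widen i k h x :
  (real_shift (w i) h x 0 ord_max = x 0 ord_max) *
  (real_shift (w i) h x 0 (w k) = x 0 (w k) + (if k == i then h else 0)) *
  (real_shift ord_max h x 0 ord_max = x 0 ord_max + h) *
  (real_shift ord_max h x 0 (w k) = x 0 (w k)).
Proof.
rewrite !real_shiftE eqxx widen_ord_max eq_sym widen_ord_max eq_widen.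
by do !split=> //; case: ifP; rewrite ?addr0.
Qed.

(** Along the first n directions the slice of [D] is the whole line; along the last one it is a
    translate of [I]. *)
Lemma nonisolated_real_shift j x :
  D x -> nonisolated [set h | D (real_shift j h x)] 0.
Proof.
move=> Dx; have [->|[i ->]] := ord_max_or_widen j.
  rewrite (_ : mkset _ = [set h | I (x 0 ord_max + h)]).
    exact/nonisolated_shift/accI.
  by apply/funext => h /=; rewrite real_shiftE eqxx.
rewrite (_ : mkset _ = setT); first exact: nonisolated_setT.
by apply/seteqP; split=> // h _ /=; rewrite real_shiftE eq_sym widen_ord_max.
Qed.

Lemma is_pderive_widen_f_ansatz p r i x :
  is_pd (w i) (f_ansatz p r) x (p i (x 0 ord_max) * x 0 (w i)).
Proof.
set t := x 0 ord_max.
rewrite /is_pderive (_ : (fun h => _) = fun h =>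
    2^-1 * \sum_k p k t * (x 0 (w k) + (if k == i then h else 0)) ^+ 2 + r t);
  last first.
  apply/funext => h; rewrite /f_ansatz (real_shift_widen i i h x).1.1.1.
  congr (_ * _ + _); apply: eq_bigr => k _.
  by rewrite (real_shift_widen i k h x).1.1.2.
(* The expected value is put into the shape produced by the sum rule: a zero for the constant [r t]
   and a zero for each index other than [i]. *)
rewrite -[p i t * _]addr0.
rewrite (_ : p i t * _ =
    2^-1 * \sum_k p k t * (if k == i then 2 * x 0 (w k) else 0)); last first.
  rewrite (bigD1 i) //= eqxx big1 ?addr0; first by field.
  by move=> k /negbTE ->; rewrite mulr0.
apply: is_derive_withinD; last exact: is_derive_within_cst.
apply: is_derive_withinZ; apply: is_derive_within_sum => k.
apply: is_derive_withinZ; case: (k == i); last exact: is_derive_within_cst.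
exact: is_derive_within_sqr.
Qed.

(** The ansatz is linear in (p, r) with coefficients independent of s, so differentiating in s
    preserves its form. This serves for both the first and the second derivative in s. *)
Lemma is_pderive_max_f_ansatz p p1 r r1 x : D x ->
  (forall i t, I t -> is_derive_within I (p i) t (p1 i t)) ->
  (forall t, I t -> is_derive_within I r t (r1 t)) ->
  is_pd ord_max (f_ansatz p r) x (f_ansatz p1 r1 x).
Proof.
move=> Dx hp hr; set t := x 0 ord_max.
rewrite /is_pderive (_ : mkset _ = [set h | I (t + h)]); last first.
  by apply/funext => h /=; rewrite real_shiftE eqxx.
rewrite (_ : (fun h => _) = fun h =>
    2^-1 * \sum_k x 0 (w k) ^+ 2 * p k (t + h) + r (t + h)); last first.
  apply/funext => h; rewrite /f_ansatz real_shiftE eqxx.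
  congr (_ * _ + _); apply: eq_bigr => k _.
  by rewrite real_shiftE widen_ord_max mulrC.
rewrite /f_ansatz; under eq_bigr do rewrite mulrC.
apply: is_derive_withinD; last exact/is_derive_within_shift/hr.
apply: is_derive_withinZ; apply: is_derive_within_sum => k.
exact/is_derive_withinZ/is_derive_within_shift/hp.
Qed.

Lemma is_pderive_widen_mul (q : R -> R) i j x :
  is_pd (w j) (fun y => q (y 0 ord_max) * y 0 (w i)) x
    (q (x 0 ord_max) *+ (i == j)).
Proof.
set t := x 0 ord_max.
rewrite /is_pderive (_ : (fun h => _) = fun h =>
    q t * (x 0 (w i) + (if i == j then h else 0))); last first.
  apply/funext => h; rewrite (real_shift_widen j i h x).1.1.1.
  by rewrite (real_shift_widen j i h x).1.1.2.
rewrite -mulr_natr; apply: is_derive_withinZ; case: eqP => _.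
  exact: is_derive_within_add_cst.
exact: is_derive_within_cst.
Qed.

Lemma is_pderive_max_mul (q q1 : R -> R) i x : D x ->
  (forall t, I t -> is_derive_within I q t (q1 t)) ->
  is_pd ord_max (fun y => q (y 0 ord_max) * y 0 (w i)) x
    (q1 (x 0 ord_max) * x 0 (w i)).
Proof.
move=> Dx hq; set t := x 0 ord_max.
rewrite /is_pderive (_ : mkset _ = [set h | I (t + h)]); last first.
  by apply/funext => h /=; rewrite real_shiftE eqxx.
rewrite (_ : (fun h => _) = fun h => x 0 (w i) * q (t + h)); last first.
  by apply/funext => h; rewrite !real_shiftE eqxx widen_ord_max mulrC.
rewrite mulrC.
exact/is_derive_withinZ/is_derive_within_shift/hq.
Qed.

(** Candidate gradient, with [p1] and [r1] standing for p' and r'; [unlift ord_max] returns [None]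
    exactly for the coordinate s. *)
Definition f_ansatz1 p p1 r1 (j : 'I_n.+1) x : R :=
  if unlift ord_max j is Some i then p i (x 0 ord_max) * x 0 (w i)
  else f_ansatz p1 r1 x.

(** Candidate Hessian: the arrow matrix. *)
Definition f_ansatz2 p p1 p2 r2 (j k : 'I_n.+1) x : R :=
  match unlift ord_max j, unlift ord_max k with
  | Some i, Some i' => p i (x 0 ord_max) *+ (i == i')
  | Some i, None | None, Some i => p1 i (x 0 ord_max) * x 0 (w i)
  | None, None => f_ansatz p2 r2 x
  end.

Lemma is_pderive_f_ansatz p p1 r r1 :
  (forall i t, I t -> is_derive_within I (p i) t (p1 i t)) ->
  (forall t, I t -> is_derive_within I r t (r1 t)) ->
  forall j x, D x -> is_pd j (f_ansatz p r) x (f_ansatz1 p p1 r1 j x).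
Proof.
move=> hp hr j x Dx; rewrite /f_ansatz1.
have [->|[i ->]] := ord_max_or_widen j.
  by rewrite unlift_none; exact: is_pderive_max_f_ansatz.
by rewrite unlift_widen; exact: is_pderive_widen_f_ansatz.
Qed.

Lemma is_pderive2_f_ansatz p p1 p2 r1 r2 :
  (forall i t, I t -> is_derive_within I (p i) t (p1 i t)) ->
  (forall i t, I t -> is_derive_within I (p1 i) t (p2 i t)) ->
  (forall t, I t -> is_derive_within I r1 t (r2 t)) ->
  forall j k x, D x ->
    is_pd j (f_ansatz1 p p1 r1 k) x (f_ansatz2 p p1 p2 r2 j k x).
Proof.
move=> hp hp1 hr1 j k x Dx; rewrite /f_ansatz2 /f_ansatz1.
have [->|[i ->]] := ord_max_or_widen k.
  rewrite unlift_none; have [->|[i ->]] := ord_max_or_widen j.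
    by rewrite unlift_none; exact: is_pderive_max_f_ansatz.
  by rewrite unlift_widen; exact: is_pderive_widen_f_ansatz.
rewrite unlift_widen; have [->|[j' ->]] := ord_max_or_widen j.
  by rewrite unlift_none; apply: is_pderive_max_mul => //; exact: hp.
(* Off the diagonal both multiples are zero, so the index of p may be exchanged. *)
rewrite unlift_widen eq_sym (_ : p j' _ *+ _ = p i (x 0 ord_max) *+ (i == j')).
  exact: is_pderive_widen_mul.
by case: eqP => [->|].
Qed.

End RealAnsatz.

(** * Complex Hessians of functions of the real parts *)

Section TubeFunction.
Variables (R : realType) (n : nat) (D : set 'rV[R]_n).
Hypothesis accD :
  forall j x, D x -> nonisolated [set h | D (real_shift j h x)] 0.
Local Notation re := (map_mx (@complex.Re R)).
Local Notation DC := [set z : 'rV[R[i]]_n | D (re z)].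
Local Notation is_cpd := (is_pderive (@complex_shift R n) DC).
Implicit Types (z : 'rV[R[i]]_n) (f : 'rV[R]_n -> R).

Lemma complex_shift0 jb z : complex_shift jb 0 z = z.
Proof. by rewrite /complex_shift; case: jb.2; rewrite scale0r addr0. Qed.

Lemma re_complex_shift j b h z :
  re (complex_shift (j, b) h z) = if b then re z else real_shift j h (re z).
Proof.
case: b; apply/rowP => k; rewrite !mxE ?eqxx /=; case: (z 0 k) => a b;
  by case: (k == j); rewrite /= ?(mulr1, mulr0, mul0r, subr0, addr0, oppr0).
Qed.

Lemma nonisolated_complex_shift jb z :
  DC z -> nonisolated [set h | DC (complex_shift jb h z)] 0.
Proof.
case: jb => j b Dz; rewrite (_ : mkset _ =
    if b then setT else [set h | D (real_shift j h (re z))]); last first.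
  by apply/seteqP; case: b; split=> h /=; rewrite re_complex_shift.
by case: b; [exact: nonisolated_setT | exact: accD].
Qed.

Lemma is_pderive_tube f j b z l :
  is_pderive (@real_shift R n) D j f (re z) l ->
  is_cpd (j, b) (fun w => f (re w)) z (if b then 0 else l).
Proof.
rewrite /is_pderive => H.
rewrite (_ : (fun h => f (re _)) =
    fun h => f (if b then re z else real_shift j h (re z))); last first.
  by apply/funext => h; rewrite re_complex_shift.
case: b; first exact: is_derive_within_cst.
rewrite (_ : mkset _ = [set h | D (real_shift j h (re z))]) //.
by apply/funext => h /=; rewrite re_complex_shift.
Qed.

(** Derivatives in the imaginary directions vanish, so each of the operators d/dz_j and d/dzbar_k
    acts as half of a real partial derivative; together they give the factor 1/4. *)
Lemma complex_hessian_tube f (f1 : 'I_n -> 'rV[R]_n -> R)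
    (f2 : 'I_n -> 'I_n -> 'rV[R]_n -> R) :
  (forall j x, D x -> is_pderive (@real_shift R n) D j f x (f1 j x)) ->
  (forall j k x, D x -> is_pderive (@real_shift R n) D j (f1 k) x (f2 j k x)) ->
  twice_pderivable (@complex_shift R n) DC (fun z => f (re z)) /\
  forall z, DC z -> complex_hessian DC (fun w => f (re w)) z =
    map_mx (fun a : R => a%:C) (\matrix_(j, k) (f2 j k (re z) / 4)).
Proof.
move=> H1 H2.
pose g1 (jb : 'I_n * bool) z := if jb.2 then 0 else f1 jb.1 (re z).
pose g2 (jb kb : 'I_n * bool) z :=
  if kb.2 then 0 else if jb.2 then 0 else f2 jb.1 kb.1 (re z).
have G1 jb z : DC z -> is_cpd jb (fun w => f (re w)) z (g1 jb z).
  by case: jb => j b Dz; exact/is_pderive_tube/H1.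
have G2 jb kb z : DC z -> is_cpd jb (g1 kb) z (g2 jb kb z).
  case: jb kb => j b [k [|]] Dz; first exact: is_derive_within_cst.
  exact/is_pderive_tube/H2.
have [tw E1 _] := twice_pderivableE complex_shift0 nonisolated_complex_shift G1 G2.
split=> // z Dz; apply/matrixP => j k; rewrite !mxE.
have zE v w : is_cpd v (fun=> 0) w 0 by exact: is_derive_within_cst.
have half (a : R) : a%:C / 2 = (2^-1 * a)%:C.
  by rewrite rmorphM fmorphV rmorph_nat mulrC.
(* This is needed on the whole domain, not only at [z], because the result is differentiated once
   more. Its value is real, so afterwards only the real part contributes. *)
have dzbarE w : DC w ->
    dzbar DC k (fun w => (f (re w))%:C) w = (2^-1 * g1 (k, false) w)%:C.
  move=> Dw; rewrite /dzbar /cpderive !E1// /=.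
  have z0 v : pderive (@complex_shift R n) DC v (fun=> 0) w = 0.
    exact: (pderiveE nonisolated_complex_shift Dw (zE v w)).2.
  by rewrite !z0 /g1/= [0 +i* 0](_ : _ = 0)// mulr0 addr0 -half.
have dzbar_re b : pderive (@complex_shift R n) DC (j, b)
    (fun w => complex.Re (dzbar DC k (fun w => (f (re w))%:C) w)) z =
    2^-1 * g2 (j, b) (k, false) z.
  apply: (eq_pderive complex_shift0 nonisolated_complex_shift
    (g := fun w => 2^-1 * g1 (k, false) w)) => //.
    by move=> w /dzbarE ->.
  exact/is_derive_withinZ/G2.
have dzbar_im b : pderive (@complex_shift R n) DC (j, b)
    (fun w => complex.Im (dzbar DC k (fun w => (f (re w))%:C) w)) z = 0.
  apply: (eq_pderive complex_shift0 nonisolated_complex_shift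
    (g := fun=> 0)) => //.
  by move=> w /dzbarE ->.
rewrite /dz /cpderive !dzbar_re !dzbar_im /g2/= mulr0.
rewrite [0 +i* 0](_ : _ = 0)// mulr0 subr0 half; congr (_%:C); by field.
Qed.

End TubeFunction.

(** * The Hessian equation for the two ansatz functions *)

Section Ansatz.
Variables (R : realType) (n : nat) (c : int -> R).
Implicit Types (p : 'I_n -> R -> R) (r : R -> R) (x : 'rV[R]_n.+1).

Lemma hessian_lhs_f_ansatz2 p p1 p2 r2 x :
  let s := x 0 ord_max in let ps j := p j s in
  (forall i, p2 i s / 2 * F c ps = p1 i s ^+ 2 * dF c i ps) ->
  r2 s * F c ps = - G c ps ->
  hessian_lhs c (map_mx (fun a : R => a%:C)
    (\matrix_(j, k) f_ansatz2 p p1 p2 r2 j k x)) = 0.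
Proof.
move=> s ps hp hr.
rewrite (@hessian_lhs_arrow _ _ _ ps); last first.
  by move=> i j; rewrite mxE /f_ansatz2 !unlift_widen.
apply/eqP; rewrite eq_complex /= eqxx andbT; apply/eqP.
rewrite mxE /f_ansatz2 unlift_none.
under eq_bigr => j _ do rewrite !mxE unlift_none unlift_widen.
rewrite /f_ansatz -/s; move: (F c ps) (G c ps) hp hr => A B hp hr.
(* The contribution of r'' cancels [G]; what remains is a sum over j, each term being x_j^2 times
   the defect of the j-th equation for p. *)
rewrite mulrDl hr mulr_sumr mulr_suml addrCA subrr addr0.
rewrite -sumrB big1 // => j _; have := hp j.
set X := x 0 (widen_ord _ j) => hpj.
transitivity (X ^+ 2 * (p2 j s / 2 * A - p1 j s ^+ 2 * dF c j ps)).
  by field.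
by rewrite hpj subrr mulr0.
Qed.

(** The factor 4 is absorbed into p and r, so that the results on the real ansatz apply verbatim to
    the function of the real parts. *)
Lemma u_ansatzE p r (z : 'rV[R[i]]_n.+1) :
  u_ansatz p r z =
  f_ansatz (fun j s => 4 * p j s) (fun s => 4 * r s)
    (map_mx (@complex.Re R) z).
Proof.
rewrite /u_ansatz /f_ansatz !mxE; congr (_ + _).
rewrite !mulr_sumr; by apply: eq_bigr => j _; rewrite !mxE; field.
Qed.

(** The factor 4 in u cancels the 1/4 of the complex Hessian: both equations concern the same arrow
    matrix. *)
Lemma f_ansatz2_scale p p1 p2 r2 j k x :
  f_ansatz2 (fun j s => 4 * p j s) (fun j s => 4 * p1 j s)
    (fun j s => 4 * p2 j s) (fun s => 4 * r2 s) j k x / 4 =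
  f_ansatz2 p p1 p2 r2 j k x.
Proof.
rewrite /f_ansatz2; case: unlift => [i|]; case: unlift => [i'|].
- by case: eqP => _; rewrite ?mulr0n ?mul0r// !mulr1n; field.
- by field.
- by field.
rewrite /f_ansatz mulrDl !mulr_sumr mulr_suml; congr (_ + _); last by field.
by apply: eq_bigr => i _; field.
Qed.

End Ansatz.

Theorem proposition5p1 (R : realType) (n : nat) (hn : (1 <= n)%N)
    (c : int -> R) (I : set R) (hI : is_interval I)
    (hI2 : exists a b : R, [/\ I a, I b & a < b])
    (p : 'I_n -> R -> R) (r : R -> R)
    (hp : forall i, C2_on I (p i)) (hr : C2_on I r)
    (hode_p : forall (i : 'I_n) (s : R), I s ->
       derive_within I (derive_within I (p i)) s / 2 * F c (fun j => p j s)
       = derive_within I (p i) s ^+ 2 * dF c i (fun j => p j s))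
    (hode_r : forall s : R, I s ->
       derive_within I (derive_within I r) s * F c (fun j => p j s)
       = - G c (fun j => p j s)) :
  (let D := [set z : 'rV[R[i]]_n.+1 | I (complex.Re (z 0 ord_max))] in
   twice_pderivable (@complex_shift R n.+1) D (u_ansatz p r) /\
   forall z, D z -> hessian_lhs c (complex_hessian D (u_ansatz p r) z) = 0)
  /\
  (let D := [set x : 'rV[R]_n.+1 | I (x 0 ord_max)] in
   twice_pderivable (@real_shift R n.+1) D (f_ansatz p r) /\
   forall x, D x ->
     hessian_lhs c
       (map_mx (fun a : R => a%:C) (real_hessian D (f_ansatz p r) x)) = 0).
Proof.
(* An interval with two distinct points has no isolated point, so the derivatives in the hypotheses
   are genuine limits. *)
have accI t : I t -> nonisolated I t by exact: nonisolated_interval.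
pose p1 i := derive_within I (p i); pose p2 i := derive_within I (p1 i).
pose r1 := derive_within I r; pose r2 := derive_within I r1.
have Hp i t : I t -> is_derive_within I (p i) t (p1 i t).
  by case: (hp i) => H _ _ /H/derivable_withinP.
have Hp1 i t : I t -> is_derive_within I (p1 i) t (p2 i t).
  by case: (hp i) => _ H _ /H/derivable_withinP.
have Hr t : I t -> is_derive_within I r t (r1 t).
  by case: hr => H _ _ /H/derivable_withinP.
have Hr1 t : I t -> is_derive_within I r1 t (r2 t).
  by case: hr => _ H _ /H/derivable_withinP.
split=> D.
(* The complex domain is the tube over the real one. *)
- have -> : D = [set z | I (map_mx (@complex.Re R) z 0 ord_max)].
    by apply/funext => z /=; rewrite mxE.
  have -> : u_ansatz p r = fun z => f_ansatz (fun j s => 4 * p j s)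
      (fun s => 4 * r s) (map_mx (@complex.Re R) z).
    by apply/funext => z; exact: u_ansatzE.
  have scale4 (g g1 : R -> R) :
      (forall t, I t -> is_derive_within I g t (g1 t)) ->
      forall t, I t -> is_derive_within I (fun s => 4 * g s) t (4 * g1 t).
    by move=> gg1 t /gg1; exact: is_derive_withinZ.
  have [tw hess] := complex_hessian_tube (nonisolated_real_shift accI)
    (is_pderive_f_ansatz (fun i => scale4 _ _ (Hp i)) (scale4 _ _ Hr))
    (is_pderive2_f_ansatz (fun i => scale4 _ _ (Hp i))
      (fun i => scale4 _ _ (Hp1 i)) (scale4 _ _ Hr1)).
  split=> // z Dz; rewrite hess//.
  rewrite (_ : (\matrix_(j, k) _) = \matrix_(j, k)
      f_ansatz2 p p1 p2 r2 j k (map_mx (@complex.Re R) z)).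
    by apply: hessian_lhs_f_ansatz2 => [i|]; [exact: hode_p | exact: hode_r].
  by apply/matrixP => j k; rewrite !mxE f_ansatz2_scale.
- have [tw _ E2] := twice_pderivableE (@real_shift0 R n.+1)
    (nonisolated_real_shift accI) (is_pderive_f_ansatz Hp Hr)
    (is_pderive2_f_ansatz Hp Hp1 Hr1).
  split=> // x Dx.
  rewrite (_ : real_hessian _ _ _ =
      \matrix_(j, k) f_ansatz2 p p1 p2 r2 j k x).
    by apply: hessian_lhs_f_ansatz2 => [i|]; [exact: hode_p | exact: hode_r].
  by apply/matrixP => j k; rewrite !mxE E2.
Qed.
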